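(* Consider the revenue-maximization version of the online selection problem with $C\ge1$ units and valuations in $[L,U]$, $0<L\le U$; let $\theta=U/L$ and $\alpha=1+\ln\theta$. The randomized static pricing algorithm with inverse CDF $$\psi(x)=\begin{cases} L, & x\in[0,1/\alpha),\\ L\exp(\alpha x-1), & x\in[1/\alpha,1],\end{cases}$$ achieves the optimal competitive ratio $\alpha=1+\ln\theta$ for maximizing revenue; that is, its competitive ratio for revenue is at most $1+\ln\theta$, and no online algorithm, deterministic or randomized, has a competitive ratio for revenue smaller than $1+\ln\theta$.
   Context: Online selection problem: a seller has $C$ identical units of an item. Buyers $n=1,\dots,N$ arrive one at a time; buyer $n$ has a private valuation $v_n\in[L,U]$. An instance is $I=(v_1,\dots,v_N)$, with $N$ and the valuations unknown in advance. On arrival of buyer $n$ a price $p_n$ is posted; buyer $n$ buys one unit and pays $p_n$ ($x_n=1$) if $v_n\ge p_n$ and fewer than $C$ units have been sold so far, otherwise $x_n=0$. A deterministic online algorithm determines $p_n$ as a function of the past decisions $x_1,\dots,x_{n-1}$ only; a randomized one is a probability distribution over deterministic ones. The revenue is $\sum_n p_nx_n$; $\mathrm{ALG}(I)$ denotes that of the algorithm. The offline optimal revenue $\mathrm{OPT}(I)$ is the sum of the $\min\{C,N\}$ largest valuations (the offline seller can post prices equal to valuations). The competitive ratio for revenue is $\sup_I\mathrm{OPT}(I)/\mathbb{E}[\mathrm{ALG}(I)]$. Static pricing algorithm with inverse CDF $\psi$: before any arrival, draw $x$ uniformly from $[0,1]$; then post the same price $p=\psi(x)$ to all buyers, selling one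 unit to each buyer with $v_n\ge p$ as long as units remain. *)

(* Defs.v *)
From HB Require Import structures.
From mathcomp Require Import all_boot all_order all_algebra.
From mathcomp Require Import all_classical all_reals all_analysis.
From mathcomp Require Import measurable_realfun.

Set Implicit Arguments.
Unset Strict Implicit.
Unset Printing Implicit Defensive.

Import Order.TTheory GRing.Theory Num.Theory.
Import numFieldNormedType.Exports.

Local Open Scope classical_set_scope.
Local Open Scope ring_scope.

(* [v_1; ...; v_N] with N >= 1; for N = 0 the ratio OPT/ALG would be 0/0. *)
Definition is_instance (R : realType) (L U : R) (I : seq R) : Prop :=
  I <> [::] /\ forall v, v \in I -> L <= v <= U.

(* The price posted to buyer n as a function of the past decisions
   [x_1; ...; x_(n-1)], in chronological order.  Prices are arbitrary reals. *)
Definition price_policy (R : realType) : Type := seq bool -> R.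

(* [xs] lists the decisions already taken; the head of [I] is the buyer now
   arriving. *)
Fixpoint revenue_after (R : realType) (C : nat) (A : price_policy R)
    (xs : seq bool) (I : seq R) : R :=
  if I is v :: I' then
    let p := A xs in
    let x := (p <= v) && (count id xs < C)%N in
    p *+ x + revenue_after C A (rcons xs x) I'
  else 0.

Definition revenue (R : realType) (C : nat) (A : price_policy R) (I : seq R)
    : R :=
  revenue_after C A [::] I.

(* [take C s] is [s] itself when [size s <= C]. *)
Definition opt_revenue (R : realType) (C : nat) (I : seq R) : R :=
  \sum_(v <- take C (sort (fun x y => y <= x) I)) v.

(* The measurable sets of policies are generated by the evaluations at each
   history, i.e. they form the product sigma-algebra on R^(seq bool). *)
Definition policy_cylinders (R : realType) : set (set (price_policy R)) :=
  [set S | exists (xs : seq bool) (B : set R),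
     measurable B /\ S = [set A : price_policy R | B (A xs)]].

Notation policy_space R := (g_sigma_algebraType (@policy_cylinders R)).

Definition randomized_policy (R : realType) : Type :=
  probability (policy_space R) R.

Definition expected_revenue (R : realType) (C : nat) (P : randomized_policy R)
    (I : seq R) : \bar R :=
  'E_P[fun A : policy_space R => revenue C A I].

(* OPT > 0 on every instance when 0 < L and 0 < C, so a nonpositive ALG (which
   includes -oo, as prices may be negative) gets ratio +oo. *)
Definition revenue_ratio (R : realType) (opt : R) (alg : \bar R) : \bar R :=
  if (0 < alg)%E then (opt%:E / alg)%E else +oo%E.

Definition competitive_ratio (R : realType) (C : nat) (L U : R)
    (alg : seq R -> \bar R) : \bar R :=
  ereal_sup [set revenue_ratio (opt_revenue C I) (alg I) | I in is_instance L U].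

Definition static_policy (R : realType) (p : R) : policy_space R := fun=> p.

Lemma measurable_static_policy (R : realType) :
  measurable_fun [set: R] (@static_policy R).
Proof.
apply: measurability; first reflexivity.
move=> _ [_ [xs [B [mB ->]]] <-].
by rewrite setTI.
Qed.

HB.instance Definition _ (R : realType) :=
  isMeasurableFun.Build _ _ _ _ (@static_policy R)
    (@measurable_static_policy R).

(* The law of the policy posting the price psi(x) forever, x uniform on [0,1];
   the values of psi outside [0,1] are irrelevant. *)
Definition static_pricing (R : realType) (psi : {mfun measurableTypeR R >-> R})
    : randomized_policy R :=
  distribution (uniform_prob (@ltr01 R)) (@static_policy R \o psi).

Definition revenue_alpha (R : realType) (L U : R) : R := 1 + ln (U / L).

Definition revenue_psi (R : realType) (L U : R) (x : measurableTypeR R)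
    : R :=
  if x < 1 / revenue_alpha L U then L
  else L * expR (revenue_alpha L U * x - 1).

Lemma measurable_revenue_psi (R : realType) (L U : R) :
  measurable_fun setT (revenue_psi L U).
Proof.
suff : measurable_fun [set: R] (revenue_psi L U : R -> R) by [].
apply: measurable_fun_ifT => //; first exact: measurable_fun_ltr.
apply: measurable_funM => //; apply: measurableT_comp => //.
by apply: measurable_funB => //; exact: measurable_funM.
Qed.

HB.instance Definition _ (R : realType) (L U : R) :=
  isMeasurableFun.Build _ _ _ _ (revenue_psi L U)
    (@measurable_revenue_psi R L U).

(* Main.v *)
(* Upper bound: a static price p earns the sum of p 1[p <= w] over the C largest
   valuations w, and psi is chosen so that E[psi 1[psi <= w]] = w / alpha for
   every w in [L, U]; hence E[ALG] = OPT / alpha exactly.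

   Lower bound: let v_i = L theta^(i/k) and let I_i consist of C buyers at each
   of the levels v_0 < ... < v_i.  Give I_i the weight 1/v_i - 1/v_(i+1) for
   i < k and 1/v_k for i = k.  Since I_0, ..., I_k are prefixes of each other,
   every policy has weighted total revenue at most C, whereas the weighted total
   of C v_i is C (1 + k (1 - theta^(-1/k))).  Averaging gives the same bound for
   randomized policies, and k -> oo gives 1 + ln theta. *)
Require Import Defs.
From HB Require Import structures.
From mathcomp Require Import all_boot all_order all_algebra.
From mathcomp Require Import all_classical all_reals all_analysis.
From mathcomp Require Import measurable_realfun zify ring lra.

Import Order.TTheory GRing.Theory Num.Theory.
Import numFieldNormedType.Exports.
Local Open Scope classical_set_scope.
Local Open Scope ring_scope.

(** The instance I_i of the lower bound is [block_instance C v 0 i.+1]; a general starting level [j]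
    lets an induction peel off the lowest block. *)
Definition block_instance {R : realType} C (v : nat -> R) j n : seq R :=
  flatten [seq nseq C (v i) | i <- iota j n].

(** * Revenue of a fixed policy, and the offline optimum *)

Section Combinatorics.
Set Implicit Arguments.
Variable R : realType.
Implicit Types (A : price_policy R) (C : nat) (I s t : seq R) (xs : seq bool).

(** Decisions on [s] cannot depend on later buyers, so a single extension [ys] of the history serves
    every continuation [t]. A sale never brings more than the buyer's valuation, whence the bound by
    [w] per unit sold. *)
Lemma revenue_after_cat C A xs s : (count id xs <= C)%N ->
  exists ys, (count id (xs ++ ys) <= C)%N /\
    (forall t, revenue_after C A xs (s ++ t) =
       revenue_after C A xs s + revenue_after C A (xs ++ ys) t) /\
    (forall w, (forall v, v \in s -> v <= w) ->
       revenue_after C A xs s <= w * (count id ys)%:R).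
Proof.
elim: s xs => [|v s IH] xs xsC.
  exists [::]; rewrite cats0; split=> //; split=> [t|w _] /=.
    by rewrite add0r.
  by rewrite mulr0.
pose x := (A xs <= v) && (count id xs < C)%N.
have xsC' : (count id (rcons xs x) <= C)%N.
  rewrite -cats1 count_cat /= addn0 /x.
  by case: (A xs <= v) => /=; rewrite ?addn0 //; lia.
have [ys [ysC [ysE ysle]]] := IH _ xsC'.
exists (x :: ys); rewrite -cat_rcons; split=> //; split=> [t|w sw] /=.
  by rewrite -/x ysE addrA.
rewrite -/x natrD mulrDr; apply: lerD.
  case E: x => /=; rewrite ?mulr0n ?mulr1n ?mulr0 ?mulr1 //.
  move: E; rewrite /x => /andP[pv _]; apply: (le_trans pv).
  by apply: sw; rewrite mem_head.
by apply: ysle => u us; apply: sw; rewrite in_cons us orbT.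
Qed.

Lemma revenue_le C A I w : 0 <= w -> (forall v, v \in I -> v <= w) ->
  revenue C A I <= w * C%:R.
Proof.
move=> w0 Iw.
have [//|ys [/= ysC [_ /(_ _ Iw) h]]] := @revenue_after_cat C A [::] I.
by apply: (le_trans h); rewrite ler_wpM2l // ler_nat.
Qed.

(* The weights turn the revenue extracted from the block at level [v i] into
   at most the number of units sold there (Abel summation). *)
Lemma weighted_block_revenue_le C A (v : nat -> R) n j xs :
  (forall i, 0 < v i) -> (forall i, v i <= v i.+1) -> (count id xs <= C)%N ->
  \sum_(i < n) ((v (j + i)%N)^-1 - (v (j + i).+1)^-1) *
      revenue_after C A xs (block_instance C v j i.+1) +
    (v (j + n)%N)^-1 * revenue_after C A xs (block_instance C v j n.+1)
  <= C%:R - (count id xs)%:R.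
Proof.
move=> v0 vS; elim: n j xs => [|n IH] j xs xsC;
  have [ys [ysC [ysE ysle]]] := @revenue_after_cat C A xs (nseq C (v j)) xsC;
  have {}ysle : (v j)^-1 * revenue_after C A xs (nseq C (v j))
    <= (count id ys)%:R by
   [rewrite ler_pdivrMl //; apply: ysle => u /nseqP[-> _]].
  rewrite big_ord0 add0r addn0 /block_instance /= cats0.
  apply: (le_trans ysle); rewrite lerBrDl -natrD ler_nat.
  by rewrite -count_cat.
set r := revenue_after C A xs (nseq C (v j)) in ysE ysle.
have blockE m : revenue_after C A xs (block_instance C v j m.+1) =
    r + revenue_after C A (xs ++ ys) (block_instance C v j.+1 m) by apply: ysE.
(* The first block is common to all the prefixes, so its revenue [r] is collected with every weight.
   With the first and last weights added, this telescoping sum gives [r] the total weight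
   [(v j)^-1], which is what [ysle] controls. *)
have tele : \sum_(i < n) ((v (j.+1 + i)%N)^-1 - (v (j.+1 + i).+1)^-1) =
    (v j.+1)^-1 - (v (j.+1 + n)%N)^-1.
  elim: (n) => [|m IHm]; first by rewrite big_ord0 addn0 subrr.
  by rewrite big_ord_recr /= IHm !addnS; ring.
rewrite big_ord_recl /= addn0.
under eq_bigr do rewrite /bump /= add1n addnS -addSn blockE mulrDr.
rewrite big_split /= -mulr_suml tele !blockE addnS -addSn.
rewrite {1}/block_instance /= addr0.
have /= := IH j.+1 (xs ++ ys) ysC.
set S := \sum_(i < n) _; set T := revenue_after _ _ _ _ => h.
rewrite count_cat natrD in h.
move: ysle; set a := (v j)^-1; set b := (v j.+1)^-1.
set c := (v _)^-1 in h *.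
move: h; nra.
Qed.

(** In a decreasing list the entries at least [p] form a prefix, so keeping [C] entries only caps
    their number at [C]. *)
Lemma count_take_sort C I (p : R) :
  count (fun v => p <= v) (take C (sort (fun x y => y <= x) I)) =
  minn C (count (fun v => p <= v) I).
Proof.
rewrite -(permP (permEl (perm_sort (fun x y => y <= x) I))).
have := @sort_sorted R (fun x y => y <= x)
  (fun x y => le_total y x) I.
elim: (sort _ I) C => [|v s IH] [|C] //= sv; rewrite ?min0n //.
have /IH -> := path_sorted sv.
case: (leP p v) => pv; first by rewrite !add1n minnSS.
rewrite (_ : count _ s = 0%N) ?minn0 //; apply/eqP.
rewrite -leqn0 leqNgt -has_count -all_predC; apply/allP => u us /=.
have tr : transitive (fun x y : R => y <= x).
  by move=> y x z /= h1 h2; apply: le_trans h2 h1.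
by rewrite -ltNge; apply: le_lt_trans pv; exact: (allP (order_path_min tr sv)).
Qed.

Lemma opt_revenue_ge C I w : (forall v, v \in I -> 0 <= v) ->
  (C <= count (fun v => w <= v)%R I)%N -> w * C%:R <= opt_revenue C I.
Proof.
move=> I0 CI; rewrite -{1}(minn_idPl CI) -count_take_sort /opt_revenue.
set s := take _ _.
have {I0} : forall v, v \in s -> 0 <= v.
  by move=> v /mem_take; rewrite mem_sort; exact: I0.
elim: s => [|v s IH] s0 /=; first by rewrite big_nil mulr0.
rewrite big_cons natrD mulrDr; apply: lerD.
  have := s0 v (mem_head _ _).
  by case: (leP w v); rewrite ?mulr0 ?mulr1.
by apply: IH => u us; apply: s0; rewrite in_cons us orbT.
Qed.

Lemma revenue_after_static C (p : R) xs I : (count id xs <= C)%N ->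
  revenue_after C (fun=> p) xs I =
  p *+ minn (C - count id xs) (count (fun v => p <= v)%R I).
Proof.
elim: I xs => [|v I IH] xs xsC /=; first by rewrite minn0.
rewrite IH; last first.
  rewrite -cats1 count_cat /= addn0.
  by case: (p <= v) => /=; rewrite ?addn0 //; lia.
rewrite -mulrnDr -cats1 count_cat /= addn0; congr (_ *+ _).
by case: (p <= v) => /=; lia.
Qed.

(** This puts the revenue in the form of a sum over the same list as [opt_revenue], so that
    expectations can be compared one valuation at a time. *)
Lemma revenue_static C (p : R) I : revenue C (fun=> p) I =
  \sum_(v <- take C (sort (fun x y => y <= x) I)) p *+ (p <= v)%R.
Proof.
rewrite /revenue revenue_after_static // subn0 -count_take_sort.
elim: take => [|v s IH]; first by rewrite big_nil.
by rewrite big_cons /= mulrnDr IH.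
Qed.

End Combinatorics.

(** * Measurability and expectation of the revenue *)

Section ExpectedRevenue.
Set Implicit Arguments.
Variable R : realType.
Implicit Types (A : price_policy R) (C : nat) (I : seq R) (xs : seq bool).

Lemma measurable_revenue C I :
  measurable_fun [set: policy_space R] (fun A => revenue C A I).
Proof.
rewrite /revenue; elim: I [::] => [|v I IH] xs /=; first exact: measurable_cst.
have mxs : measurable_fun [set: policy_space R]
    (fun A : policy_space R => A xs : R).
  move=> _ B mB; rewrite setTI; apply: sub_sigma_algebra.
  by exists xs, B.
set b := (count id xs < C)%N.
(* On each side of the test [A xs <= v] the next history is a fixed list, so the induction
   hypothesis applies to both branches. *)
rewrite (_ : (fun A => _) = (fun A : policy_space R => if A xs <= v
    then A xs *+ b + revenue_after C A (rcons xs b) I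
    else revenue_after C A (rcons xs false) I)); last first.
  by apply/funext => A; case: (A xs <= v); rewrite /= ?mulr0n ?add0r.
apply: measurable_fun_ifT => //; first exact: measurable_fun_ler.
apply: measurable_funD => //.
by case: b.
Qed.

(** Negative prices may drive the expectation to -oo, but the positive part of the revenue is
    bounded by [C] times a bound on the valuations. *)
Lemma expected_revenue_lty C (P : randomized_policy R) I :
  (expected_revenue C P I < +oo)%E.
Proof.
have [w w0 Iw] : exists2 w, 0 <= w & forall v, v \in I -> v <= w.
  exists (\sum_(v <- I) `|v|); first exact: sumr_ge0.
  elim: I => // u I IH v; rewrite in_cons big_cons => /predU1P[->|/IH vI].
      rewrite (le_trans (ler_norm u)) // lerDl; exact: sumr_ge0.
  by apply: (le_trans vI); rewrite lerDr.
rewrite /expected_revenue unlock integralE.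
have le_pos : (\int[P]_A ((fun A => (revenue C A I)%:E)^\+ A) <= (w * C%:R)%:E)%E.
  have -> : (w * C%:R)%:E = (\int[P]_A (cst (w * C%:R)%:E A))%E.
    by rewrite integral_cst //= probability_setT mule1.
  apply: ge0_le_integral => //.
  - by apply/measurable_funepos/measurable_EFinP; exact: measurable_revenue.
  - move=> A _ /=; rewrite funeposE ge_max !lee_fin mulr_ge0 // andbT.
    exact: revenue_le.
have neg0 : (0 <= \int[P]_A ((fun A => (revenue C A I)%:E)^\- A))%E.
  exact: integral_ge0.
apply: (@le_lt_trans _ _ (w * C%:R)%:E); last exact: ltry.
apply: le_trans le_pos; rewrite -[leRHS]adde0.
by apply: leeD2l; rewrite oppe_le0.
Qed.

(* Linearity of the expectation, available because a positive expectation
   of a revenue bounded above forces integrability. *)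
Lemma expected_revenue_comb_le C (P : randomized_policy R) n (w : 'I_n -> R)
    (J : 'I_n -> seq R) (b : R) :
  (forall i, 0 < expected_revenue C P (J i))%E ->
  (forall A, \sum_(i < n) w i * revenue C A (J i) <= b) ->
  \sum_(i < n) w i * fine (expected_revenue C P (J i)) <= b.
Proof.
move=> J0 Jb.
have Jfin i : expected_revenue C P (J i) \is a fin_num.
  by rewrite gt0_fin_numE // expected_revenue_lty.
have Jint i : P.-integrable setT (fun A => (revenue C A (J i))%:E).
  apply/integrableP; split; first by apply/measurable_EFinP; exact: measurable_revenue.
  rewrite integral_fin_num_abs //; last exact: measurable_revenue.
  by have := Jfin i; rewrite /expected_revenue unlock.
rewrite -lee_fin -sumEFin.
under eq_bigr do rewrite EFinM fineK // /expected_revenue unlock -integralZl //.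
rewrite -integral_sum //; last by move=> i; exact: integrableZl.
have -> : b%:E = (\int[P]_A (cst b%:E A))%E.
  by rewrite integral_cst //= probability_setT mule1.
apply: le_integral => //.
- by apply: integrable_sum => // i _; exact: integrableZl.
- by apply/finite_measure_integrable_cst.
- by move=> A _; rewrite sumEFin lee_fin.
Qed.

End ExpectedRevenue.

(** * Lower bound on the competitive ratio *)

Section CompetitiveRatioLowerBound.
Set Implicit Arguments.
Variable R : realType.
Implicit Types (C : nat) (L U : R).

Lemma block_instance_count C (v : nat -> R) i :
  (C <= count (fun u => v i <= u)%R (block_instance C v 0 i.+1))%N.
Proof.
rewrite /block_instance -addn1 iotaD map_cat flatten_cat count_cat /= cats0.
by rewrite count_nseq /= lexx mul1n leq_addl.
Qed.

Lemma competitive_ratio_randomized_ge C L U (P : randomized_policy R) :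
  (1 <= C)%N -> 0 < L -> L <= U ->
  ((1 + ln (U / L))%:E <= competitive_ratio C L U (expected_revenue C P))%E.
Proof.
move=> C0 L0 LU; set T := ln (U / L); set cr := competitive_ratio _ _ _ _.
have UE : U = L * expR T.
  by rewrite /T lnK ?posrE ?divr_gt0 ?(lt_le_trans L0) // mulrC divfK ?gt_eqF.
have T0 : 0 <= T by rewrite ln_ge0 // ler_pdivlMr // mul1r.
rewrite leNgt; apply/negP => cr_lt.
(* As [cr] is below a real number, no instance has ratio +oo, which is the value assigned to a
   nonpositive expected revenue. *)
have ratio I : is_instance L U I -> (0 < expected_revenue C P I)%E /\
    ((opt_revenue C I / fine (expected_revenue C P I))%:E <= cr)%E.
  move=> hI.
  have := ereal_sup_ubound (imageP (fun I =>
    revenue_ratio (opt_revenue C I) (expected_revenue C P I)) hI).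
  rewrite -/(competitive_ratio C L U _) -/cr /revenue_ratio.
  case: ifPn => [E0 h|_ h]; last first.
    by have := le_lt_trans h cr_lt; rewrite ltNge leey.
  split=> //; move: h E0 (expected_revenue_lty C P I).
  case: (expected_revenue C P I) => [e||] //= h; rewrite lte_fin => e0 _.
  by move: h; rewrite inver gt_eqF.
(* Instead of a limit, one [k] is fixed with T^2 / k < 1 + T - cr; then [t] is the logarithmic step
   between levels, so [v k] is [U]. *)
pose k := Num.bound (T ^+ 2 / (1 + T - fine cr)).
pose t := T / k%:R.
pose v (i : nat) := L * expR (t * i%:R).
pose J i := block_instance C v 0 i.+1.
have v0 i : 0 < v i by rewrite mulr_gt0 ?expR_gt0.
have t0 : 0 <= t by rewrite divr_ge0.
have vS i : v i <= v i.+1.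
  by rewrite ler_pM2l // ler_expR ler_wpM2l // ler_nat.
have vL i : L <= v i.
  by rewrite -[leLHS]mulr1 ler_pM2l // -[leLHS]expR0 ler_expR mulr_ge0.
have vU i : (0 < k)%N -> (i <= k)%N -> v i <= U.
  move=> k0 ik; rewrite UE ler_pM2l // ler_expR /t mulrAC.
  by rewrite ler_pdivrMr ?ltr0n // ler_wpM2l // ler_nat.
have Jlo i u : u \in J i -> exists2 j, (j <= i)%N & u = v j.
  move=> /flatten_mapP[j]; rewrite mem_iota => /andP[_ ji] /nseqP[-> _].
  by exists j.
have Jopt i : v i * C%:R <= opt_revenue C (J i).
  apply: opt_revenue_ge; last exact: block_instance_count.
  by move=> u /Jlo[j _ ->]; exact: ltW.
have Jinst i : (0 < k)%N -> (i <= k)%N -> is_instance L U (J i).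
  move=> k0 ik; split=> [J0|u /Jlo[j ji ->]].
    have := block_instance_count C v i.
    by rewrite -/(J i) J0 /= leqn0 -leqn0 leqNgt C0.
  by rewrite vL vU // (leq_trans ji).
have cr_fin : cr \is a fin_num.
  have [|_ h] := ratio [:: L].
    by split=> // u; rewrite inE => /eqP ->; rewrite lexx.
  rewrite fin_numE; apply/andP; split; apply/eqP => crE.
    by move: h; rewrite crE leeNy_eq.
  by move: cr_lt; rewrite crE.
have c_lt : fine cr < 1 + T by rewrite -lte_fin fineK.
have x0 : 0 <= T ^+ 2 / (1 + T - fine cr).
  by rewrite divr_ge0 ?sqr_ge0 // subr_ge0 ltW.
have x_k := archi_boundP x0; rewrite -/k in x_k.
have k0 : (0 < k)%N by rewrite -(ltr0n R); exact: le_lt_trans x_k.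
pose e i := fine (expected_revenue C P (J i)).
have e0 i : (i <= k)%N -> 0 < e i.
  move=> ik; have [E0 _] := ratio _ (Jinst _ k0 ik).
  by apply: fine_gt0; rewrite E0 expected_revenue_lty.
have ve i : (i <= k)%N -> v i * C%:R <= fine cr * e i.
  move=> ik; have [_] := ratio _ (Jinst _ k0 ik).
  rewrite -[cr]fineK // lee_fin ler_pdivrMr ?e0 //.
  exact: le_trans.
pose w i := if (i < k)%N then (v i)^-1 - (v i.+1)^-1 else (v i)^-1.
have w0 i : 0 <= w i.
  rewrite /w; case: ifP => _; last by rewrite invr_ge0 ltW.
  by rewrite subr_ge0 lef_pV2 ?posrE.
have we : \sum_(i < k.+1) w i * e i <= C%:R.
  apply: expected_revenue_comb_le => [i|A].
    by have [] := ratio _ (Jinst _ k0 (leq_ord i)).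
  rewrite big_ord_recr /= {2}/w ltnn.
  under eq_bigr do rewrite /w ltn_ord.
  have := @weighted_block_revenue_le R C A v k 0 [::] v0 vS isT.
  by rewrite subr0.
(* Consecutive levels have ratio [expR (- t)], so each of the first [k] terms is [1 - expR (- t)],
   and the last is 1. *)
have wv : \sum_(i < k.+1) w i * v i = 1 + k%:R * (1 - expR (- t)).
  rewrite big_ord_recr /= {2}/w ltnn mulVf ?gt_eqF // addrC; congr (_ + _).
  rewrite (eq_bigr (fun=> 1 - expR (- t))) => [|i _].
    by rewrite sumr_const card_ord mulr_natl.
  rewrite /w ltn_ord mulrBl mulVf ?gt_eqF //; congr (_ - _).
  rewrite /v -natr1 mulrDr mulr1 expRD expRN.
  by field; rewrite !gt_eqF ?expR_gt0.
have C0' : 0 < C%:R :> R by rewrite ltr0n.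
have c0 : 0 < fine cr.
  rewrite -(pmulr_lgt0 _ (e0 0%N isT)).
  by apply: lt_le_trans (ve 0%N isT); rewrite mulr_gt0.
(* The inequalities [ve] are summed with the weights [w], the right side is bounded by [we], and the
   factor [C] cancels. *)
have : 1 + k%:R * (1 - expR (- t)) <= fine cr.
  rewrite -wv -(ler_pM2r C0') mulr_suml.
  apply: le_trans (_ : fine cr * \sum_(i < k.+1) w i * e i <= _).
    rewrite mulr_sumr ler_sum // => i _.
    by rewrite -mulrA [leRHS]mulrCA ler_wpM2l // ve // leq_ord.
  by rewrite ler_pM2l.
have kt : k%:R * t = T by rewrite /t mulrC divfK ?gt_eqF ?ltr0n.
have Tt : T * t < 1 + T - fine cr.
  move: x_k; rewrite ltr_pdivrMr ?subr_gt0 // /t mulrA -expr2.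
  by rewrite ltr_pdivrMr ?ltr0n // mulrC.
have E1 := expR_ge1Dx (- t).
have E2 : expR (- t) * (1 + t) <= 1.
  rewrite expRN mulrC ler_pdivrMr ?expR_gt0 // mul1r; exact: expR_ge1Dx.
(* [E2] gives 1 - exp(-t) >= t exp(-t), and [E1] gives exp(-t) >= 1 - t. Multiplied by [k], this
   yields cr >= 1 + T - T t, against [Tt]. *)
have E3 : t * (1 - t) <= 1 - expR (- t) by nra.
have : k%:R * (t * (1 - t)) <= k%:R * (1 - expR (- t)) by rewrite ler_wpM2l.
rewrite mulrA kt; lra.
Qed.

(** Point masses carry the lower bound for randomized policies over to deterministic ones. *)
Lemma expected_revenue_dirac C (A : price_policy R) (I : seq R) :
  expected_revenue C (dirac (A : policy_space R) : randomized_policy R) I =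
  (revenue C A I)%:E.
Proof.
rewrite /expected_revenue unlock integral_dirac //.
  by rewrite diracT mul1e.
by apply/measurable_EFinP; exact: measurable_revenue.
Qed.

End CompetitiveRatioLowerBound.

(** * Exact expected revenue of the static pricing algorithm *)

Section StaticPricing.
Set Implicit Arguments.
Variables (R : realType) (L U : R).
Hypotheses (L0 : 0 < L) (LU : L <= U).
Let alpha := revenue_alpha L U.

Lemma revenue_alpha_gt0 : 0 < alpha.
Proof.
by rewrite ltr_wpDr // ln_ge0 // ler_pdivlMr // mul1r.
Qed.

Lemma revenue_psi_gt0 x : 0 < revenue_psi L U x.
Proof. by rewrite /revenue_psi; case: ifP => // _; rewrite mulr_gt0 ?expR_gt0. Qed.

(** This is the sense in which [revenue_psi] inverts the CDF w -> (1 + ln(w/L)) / alpha. On the flat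
    branch both sides hold because [L <= w]; on the other, take logarithms. *)
Lemma revenue_psi_leE x w : L <= w ->
  (revenue_psi L U x <= w) = (x <= (1 + ln (w / L)) / alpha).
Proof.
move=> Lw; have a0 := revenue_alpha_gt0.
have w0 : 0 < w := lt_le_trans L0 Lw.
rewrite ler_pdivlMr // /revenue_psi -/alpha; case: ifPn => [|_].
  rewrite ltr_pdivlMr // Lw => /ltW xa.
  by apply/esym/(le_trans xa); rewrite lerDl ln_ge0 // ler_pdivlMr // mul1r.
rewrite -ler_ln ?posrE ?mulr_gt0 ?expR_gt0 // lnM ?posrE ?expR_gt0 //.
rewrite expRK ln_div ?posrE // mulrC; apply/idP/idP; lra.
Qed.

Lemma measurable_revenue_psi_indic (w : R) : measurable_fun [set: R]
  (fun x : R => revenue_psi L U x *+ (revenue_psi L U x <= w)%R).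
Proof.
rewrite (_ : (fun x => _) = fun x : R =>
    if revenue_psi L U x <= w then revenue_psi L U x else 0); last first.
  by apply/funext => x; case: ifP.
have mpsi : measurable_fun [set: R] (revenue_psi L U : R -> R).
  exact: measurable_revenue_psi.
by apply: measurable_fun_ifT => //; exact: measurable_fun_ler.
Qed.

Lemma integral_revenue_psi (w : R) : L <= w <= U ->
  (\int[lebesgue_measure]_(x in `[0%R, 1%R])
      (revenue_psi L U x *+ (revenue_psi L U x <= w)%R)%:E = (w / alpha)%:E)%E.
Proof.
move=> /andP[Lw wU]; have a0 := revenue_alpha_gt0.
have w0 : 0 < w := lt_le_trans L0 Lw.
(* The integrand is [L] before [a], exponential on [a, b], and 0 after [b], where the price exceeds
   [w]. *)
pose a := 1 / alpha; pose b := (1 + ln (w / L)) / alpha.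
have a_gt0 : 0 < a by rewrite divr_gt0.
have ab : a <= b.
  by rewrite ler_pM2r ?invr_gt0 // lerDl ln_ge0 // ler_pdivlMr // mul1r.
have b1 : b <= 1.
  rewrite ler_pdivrMr // mul1r lerD2l ler_ln ?posrE ?divr_gt0 ?(lt_le_trans L0) //.
  by rewrite ler_pM2r ?invr_gt0.
pose g x := revenue_psi L U x *+ (revenue_psi L U x <= w)%R.
have g0 x : (0 <= (g x)%:E)%E.
  by rewrite lee_fin mulrn_wge0 // ltW // revenue_psi_gt0.
have mg D : measurable_fun D (fun x => (g x)%:E).
  apply: measurable_funTS; apply/measurable_EFinP.
  exact: measurable_revenue_psi_indic.
have -> : `[0%R, 1%R]%classic = (`[0%R, a[ `|` `[a, b]) `|` `]b, 1%R].
  apply/seteqP; split => x /=; rewrite !in_itv /=.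
    move=> /andP[x0 x1]; rewrite x0 x1.
    case: (ltP x a) => xa; first by left; left.
    by case: (leP x b) => xb; [left; right|right].
  by move=> [[|]|] /andP[h1 h2]; apply/andP; split; lra.
rewrite -[X in X = _]/(integral lebesgue_measure _ (fun x => (g x)%:E)).
rewrite ge0_integral_setU //; [|exact: measurableU|]; last first.
  rewrite disj_set2E; apply/eqP; rewrite -subset0 => x /= []; rewrite !in_itv /=.
  by move=> [|] /andP[h1 h2] /andP[h3 h4]; lra.
rewrite ge0_integral_setU //; last first.
  rewrite disj_set2E; apply/eqP; rewrite -subset0 => x /= []; rewrite !in_itv /=.
  by move=> /andP[h1 h2] /andP[h3 h4]; lra.
have -> : (\int[lebesgue_measure]_(x in `]b, 1%R]) (g x)%:E = 0)%E.
  apply: integral0_eq => x /=; rewrite in_itv /= => /andP[bx _].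
  by rewrite /g revenue_psi_leE // -/b leNgt bx mulr0n.
have -> : (\int[lebesgue_measure]_(x in `[0%R, a[) (g x)%:E = (L * a)%:E)%E.
  rewrite (eq_integral (cst L%:E)).
    rewrite integral_cst //= lebesgue_measure_itv /= lte_fin a_gt0.
    by rewrite -EFinB subr0.
  move=> x; rewrite inE /= in_itv /= => /andP[_ xa].
  rewrite /g revenue_psi_leE // -/b (le_trans (ltW xa) ab) mulr1n.
  by rewrite /revenue_psi xa.
pose f x := L * expR (alpha * x - 1).
have gf : {in `[a, b], g =1 f}.
  move=> x; rewrite in_itv /= => /andP[ax xb].
  by rewrite /g revenue_psi_leE // -/b xb mulr1n /revenue_psi ltNge ax.
have -> : (\int[lebesgue_measure]_(x in `[a, b]) (g x)%:E =
    \int[lebesgue_measure]_(x in `[a, b]) (f x)%:E)%E.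
  by apply: eq_integral => x; rewrite inE /= => /gf ->.
(* [F] is an antiderivative of [f]; [F a] equals the contribution [L * a] of the flat part, so the
   total is [F b], that is [w / alpha]. *)
pose F x := L / alpha * expR (alpha * x - 1).
have aE : alpha * a - 1 = 0 by rewrite mulrC divfK ?gt_eqF // subrr.
have bE : alpha * b - 1 = ln (w / L).
  by rewrite mulrC divfK ?gt_eqF //; ring.
have Fb : F b = w / alpha.
  by rewrite /F bE lnK ?posrE ?divr_gt0 //; field; rewrite !gt_eqF.
have Fa : F a = L / alpha by rewrite /F aE expR0 mulr1.
have dF (x : R) : is_derive x 1 F (f x).
  apply: is_derive_eq.
  rewrite /GRing.scale /= /f; field; rewrite gt_eqF //.
have cF : continuous F.
  by move=> x; apply/differentiable_continuous/derivable1_diffP.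
have cf : continuous f.
  have -> : f = fun x => alpha * F x by
    apply/funext => x; rewrite /f /F mulrA mulrCA divff ?gt_eqF // mulr1.
  by move=> x; apply: cvgM; [exact: cvg_cst|exact: cF].
have -> : (\int[lebesgue_measure]_(x in `[a, b]) (f x)%:E = (F b - F a)%:E)%E.
  (* The interval degenerates when w = L, while the fundamental theorem asks for [a < b]. *)
  have [->|nab] := eqVneq a b; first by rewrite set_itv1 integral_set1 subrr.
  rewrite EFinB; apply: continuous_FTC2.
  - by rewrite lt_neqAle nab.
  - exact: continuous_subspaceT.
  - split.
    + by move=> x _; exact: ex_derive.
    + exact/cvg_at_right_filter/cF.
    + exact/cvg_at_left_filter/cF.
  - by move=> x _; rewrite derive1E; exact: derive_val.
by rewrite adde0 -EFinD Fa Fb /a; congr (_%:E); ring.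
Qed.

Lemma expected_revenue_psi C (I : seq R) : {in I, forall v, L <= v <= U} ->
  expected_revenue C (static_pricing (revenue_psi L U)) I =
  (opt_revenue C I / alpha)%:E.
Proof.
move=> ILU.
pose s := take C (sort (fun x y => y <= x) I).
have sLU v : v \in s -> L <= v <= U.
  by move=> /mem_take; rewrite mem_sort; exact: ILU.
pose g v x := revenue_psi L U x *+ (revenue_psi L U x <= v)%R.
have mg v D : measurable_fun D (fun x => (g v x)%:E).
  apply: measurable_funTS; apply/measurable_EFinP.
  exact: measurable_revenue_psi_indic.
have g0 v x : (0 <= (g v x)%:E)%E.
  by rewrite lee_fin mulrn_wge0 // ltW // revenue_psi_gt0.
pose X := @static_policy R \o revenue_psi L U.
(* This value is computed first because its finiteness supplies the integrability needed to pass
   from the law of the policy to the uniform variable. *)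
have intE : (\int[uniform_prob (@ltr01 R)]_x (revenue C (X x) I)%:E =
    (opt_revenue C I / alpha)%:E)%E.
  under eq_integral do rewrite revenue_static -/s -sumEFin.
  rewrite integral_uniform.
  - rewrite subr0 invr1 mul1e ge0_integral_sum //;
      [|by move=> v; exact: mg|by move=> v x _; exact: g0].
    rewrite /opt_revenue -/s mulr_suml -sumEFin; apply: eq_big_seq => v vs.
    by rewrite integral_revenue_psi // sLU.
  - exact: (emeasurable_sum s (h := fun v x => (g v x)%:E) (fun v => mg v setT)).
  - by move=> x; apply: sume_ge0 => v _; exact: (g0 v x).
have mX : measurable_fun setT X by exact: measurableT_comp.
have mrX : measurable_fun setT (fun x => revenue C (X x) I).
  exact: (measurableT_comp (measurable_revenue C I) mX).
rewrite /expected_revenue unlock /static_pricing integral_distribution.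
- exact: intE.
- by apply/measurable_EFinP; exact: measurable_revenue.
- apply/integrableP; split; first exact/measurable_EFinP.
  by rewrite (integral_fin_num_abs _ measurableT mrX) intE.
Qed.

Lemma opt_revenue_gt0 C (I : seq R) : (0 < C)%N -> I <> [::] ->
  {in I, forall v, 0 < v} -> 0 < opt_revenue C I.
Proof.
case: C => // C _ I0 Ipos; rewrite /opt_revenue.
have := mem_sort (fun x y => y <= x) I; have := size_sort (fun x y => y <= x) I.
case: (sort _ I) => [|v s] /= sz smem.
  by move: sz => /esym/size0nil.
rewrite big_cons ltr_pwDl //; first by apply: Ipos; rewrite -smem mem_head.
rewrite big_seq; apply: sumr_ge0 => u /mem_take us.
by apply/ltW/Ipos; rewrite -smem in_cons us orbT.
Qed.

End StaticPricing.

Theorem lemma3 (R : realType) (C : nat) (L U : R)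
    (hC : (1 <= C)%N) (hL : 0 < L) (hLU : L <= U) :
  [/\ (competitive_ratio C L U
         (expected_revenue C (static_pricing (revenue_psi L U)))
       <= (1 + ln (U / L))%:E)%E,
      (forall A : price_policy R,
         ((1 + ln (U / L))%:E
          <= competitive_ratio C L U (fun I => (revenue C A I)%:E))%E)
    & (forall P : randomized_policy R,
         ((1 + ln (U / L))%:E
          <= competitive_ratio C L U (expected_revenue C P))%E)].
Proof.
split=> [|A|P]; last exact: competitive_ratio_randomized_ge.
- apply: ge_ereal_sup => _ [I [I0 ILU] <-].
  rewrite /revenue_ratio expected_revenue_psi //.
  have a0 := @revenue_alpha_gt0 R L U hL hLU.
  have opt0 : 0 < opt_revenue C I.
    by apply: opt_revenue_gt0 => // v /ILU/andP[+ _]; exact: lt_le_trans.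
  rewrite lte_fin divr_gt0 // inver gt_eqF ?divr_gt0 //= -EFinM lee_fin.
  by rewrite invf_div mulrC divfK ?gt_eqF.
- have -> : (fun I => (revenue C A I)%:E) =
      expected_revenue C (dirac (A : policy_space R) : randomized_policy R).
    by apply/funext => I; rewrite expected_revenue_dirac.
  exact: competitive_ratio_randomized_ge.
Qed.
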